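(* Let $p$ be a prime and let $n$ be a positive integer. Then there exists a finite solvable group $G$ with an abelian Sylow $p$-subgroup such that $b(G) = p^n = |G : O_p(G)|_p$.
   Context: All groups are finite. $\mathrm{Irr}(G)$ is the set of irreducible complex characters of $G$, and $b(G) = \max\{\chi(1) \mid \chi \in \mathrm{Irr}(G)\}$ is the largest irreducible character degree of $G$. $O_p(G)$ is the largest normal $p$-subgroup of $G$. For a positive integer $m$, $m_p$ is the largest power of $p$ dividing $m$; thus $|G:O_p(G)|_p$ is the $p$-part of the index. *)

(* Defs.v *)
From mathcomp Require Import all_boot all_order all_fingroup all_algebra.
From mathcomp Require Import all_solvable all_field all_character.

Set Implicit Arguments.
Unset Strict Implicit.
Unset Printing Implicit Defensive.

(* Degrees ['chi_i 1] live in [algC]; truncation to [nat] is exact on them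
   since they are natural numbers ([Cnat_irr1]). *)
Definition max_irr_degree (gT : finGroupType) (G : {group gT}) : nat :=
  \max_(i : Iirr G) Num.truncn ('chi[G]_i 1%g).

(* Main.v *)
Require Import Defs.
From mathcomp Require Import all_boot all_order all_fingroup all_algebra.
From mathcomp Require Import all_solvable all_field all_character.

(** Let F be a finite field whose number of nonzero elements is divisible by
    p ^ n, let C be the subgroup of order p ^ n of its cyclic multiplicative
    group, and let G be the semidirect product of the additive group of F by C
    acting by multiplication, a group of affine maps of the line. Such an F
    exists by Euler's theorem: for a prime r other than p and
    k = totient (p ^ n), p ^ n divides r ^ k - 1 ([finField_dvdn_pred]).

    Multiplication by a scalar other than 1 fixes only 0, so G is a Frobenius
    group with abelian kernel F and cyclic complement C
    ([Frobenius_scalar_action]). Everything else holds for every Frobenius group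
    with abelian kernel K and abelian complement H. An irreducible character
    whose kernel contains K is a character of the abelian group G / K, hence
    has degree 1; any other is induced from a nonprincipal linear character of
    K, hence has degree #|G : K| = #|H| ([max_irr_degree_Frobenius]). If H is
    a p-group then it is a Sylow p-subgroup of G; a normal p-subgroup of G has
    order coprime to #|K|, so it centralises K, and as it lies in H it must be
    trivial ([pcore_Frobenius_compl]). *)

Set Implicit Arguments.
Unset Strict Implicit.
Unset Printing Implicit Defensive.

Import GRing.Theory Num.Theory.

Section Frobenius.

Local Open Scope ring_scope.
Local Open Scope group_scope.

Section KernelAndComplement.

Variables (gT : finGroupType) (G K H : {group gT}).
Hypothesis frobG : [Frobenius G = K ><| H].

(** An irreducible character of G is either trivial on K, hence linear because
    G / K is isomorphic to H, or induced from an irreducible character of K,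
    hence of degree #|H| because the latter is linear. The second kind occurs
    since K is nontrivial and every nonprincipal irreducible character of K has
    inertia group K in a Frobenius group. *)
Lemma max_irr_degree_Frobenius :
  abelian K -> abelian H -> max_irr_degree G = #|H|.
Proof.
move=> abK abH; have [defG ntK _ _ _] := Frobenius_context frobG.
have [nsKG _ _ _ _] := sdprod_context defG.
have frobGK := FrobeniusWker frobG.
have abGK : abelian (G / K) by rewrite -(isog_abelian (sdprod_isog defG)).
have oGK : #|G : K| = #|H|.
  by rewrite -divgS ?normal_sub // -(sdprod_card defG) mulKn.
have degInd i : 'Ind[G] 'chi[K]_i 1 = #|H|%:R.
  by rewrite cfInd1 ?normal_sub // lin_char1 ?mulr1 ?oGK //; apply/char_abelianP.
apply/eqP; rewrite eqn_leq; apply/andP; split.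
  apply/bigmax_leqP=> j _.
  have [kerK | ] := boolP (K \subset cfker 'chi_j); last first.
    by case/(Frobenius_Ind_irrP frobGK)=> i _ ->; rewrite degInd natrK.
  rewrite lin_char1 ?truncn1 ?cardG_gt0 // lin_irr_der1.
  by apply: subset_trans kerK; rewrite der1_min ?normal_norm.
have [i nzi] := has_nonprincipal_irr ntK.
have /irrP[j def_j] := irr_induced_Frobenius_ker frobGK nzi.
rewrite -[leqLHS](natrK (R := algC)) -(degInd i) def_j.
exact: (leq_bigmax (F := fun j => Num.truncn ('chi[G]_j 1))).
Qed.

(** The complement of a Frobenius group is a Hall subgroup, its order dividing
    #|K| - 1. *)
Lemma compl_Frobenius_Sylow (p : nat) : p.-group H -> p.-Sylow(G) H.
Proof.
move=> pH; have [_ _ ntH _ _] := Frobenius_context frobG.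
have [p_pr _ [m oH]] := pgroup_pdiv pH ntH.
have piH : \pi(H) =i (p : nat_pred).
  by move=> q; rewrite /= oH pi_of_exp // pi_of_prime.
by rewrite -(eq_pHall _ _ piH) Hall_pi ?(Frobenius_compl_Hall frobG).
Qed.

(** K and 'O_p(G) are normal subgroups of coprime orders, so they commute; but
    'O_p(G) lies in the Sylow subgroup H, whose nontrivial elements fix no
    nontrivial element of K. *)
Lemma pcore_Frobenius_compl (p : nat) : p.-group H -> 'O_p(G) = 1.
Proof.
move=> pH; have [defG ntK _ _ _] := Frobenius_context frobG.
have [nsKG _ _ _ _] := sdprod_context defG.
have sOH : 'O_p(G) \subset H by apply: pcore_sub_Hall (compl_Frobenius_Sylow pH).
have cKO : K \subset 'C('O_p(G)).
  apply/commG1P/trivgP.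
  have tiKO : K :&: 'O_p(G) = 1.
    by rewrite coprime_TIg // (coprimegS sOH) // (Frobenius_coprime frobG).
  rewrite -tiKO commg_subI // subsetI subxx /=.
    by rewrite (subset_trans (normal_sub nsKG)) ?gFnorm.
  by rewrite (subset_trans (pcore_sub _ _)) ?normal_norm.
apply: contraNeq ntK => ntO; rewrite -(setIidPl cKO).
by rewrite (cent_semiregular (Frobenius_reg_ker frobG) sOH ntO).
Qed.

End KernelAndComplement.

(** A fixed-point-free action gives a Frobenius group: in the external
    semidirect product the action becomes conjugation, so the fixed points of a
    are the elements of R that commute with it. *)
Lemma Frobenius_sdprod_by (aT rT : finGroupType) (D : {group aT})
    (R : {group rT}) (to : groupAction D R) :
    R :!=: 1 -> D :!=: 1 -> {in D^#, forall a, 'C_(| to)[a] = 1} ->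
  [Frobenius [set: sdprod_by to] = sdpair1 to @* R ><| sdpair2 to @* D].
Proof.
move=> ntR ntD fpf.
apply/Frobenius_semiregularP.
- exact: sdprod_sdpair.
- by rewrite morphim_injm_eq1 ?injm_sdpair1.
- by rewrite morphim_injm_eq1 ?injm_sdpair2.
move=> y /setD1P[nty /morphimP[a Da _ def_y]]; rewrite {y}def_y in nty *.
have D1a : a \in D^#.
  by apply/setD1P; split=> //; apply: contraNneq nty => ->; rewrite morph1.
apply/trivgP/subsetP=> _ /setIP[/morphimP[x Rx _ ->] cax].
suffices: x \in 'C_(| to)[a] by rewrite fpf // => /set1P->; rewrite morph1 inE.
by rewrite gacentEsd mem_morphpre // morphim_set1 // cent_set1.
Qed.

(** The additive group of F is taken as the 1 x 1 matrices, on which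
    multiplication by units is already a group action. It is fixed-point-free:
    a *: v = v forces a = 1 or v = 0. *)
Lemma Frobenius_scalar_action (F : finFieldType) (C : {group {unit F}})
    (to := (scale_groupAction F 1 1 \ subsetT C)%gact) : C :!=: 1 ->
  [Frobenius [set: sdprod_by to]
     = sdpair1 to @* [set: 'M[F]_1] ><| sdpair2 to @* C].
Proof.
move=> ntC; apply: Frobenius_sdprod_by => // [|a /setD1P[nta Ca]].
  by apply/trivgPn; exists 1%R; rewrite ?inE ?oner_neq0.
apply/trivgP/subsetP=> v /setIP[_ /afixP fix_v].
have {fix_v} /= va : to v a = v by apply: fix_v; rewrite inE Ca set11.
rewrite inE; apply: contraR nta => /astab1_scale_act ntv.
rewrite -in_set1 -[[set 1]]ntv.
by apply/astab1P.
Qed.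

End Frobenius.

(** For a prime r > m, necessarily coprime to m, Euler's theorem makes the
    field of order r ^ totient m suitable. *)
Lemma finField_dvdn_pred m : 0 < m -> exists F : finFieldType, m %| #|F|.-1.
Proof.
move=> m_gt0.
have [r r_gt r_pr] := prime_above m.
have co_rm : coprime r m.
  rewrite prime_coprime //; apply: contraL r_gt => /dvdn_leq.
  by rewrite -leqNgt => ->.
have t_gt0 : 0 < totient m by rewrite totient_gt0.
have [F _ oF] := pPrimePowerField r_pr t_gt0; exists F.
by rewrite oF -subn1 -eqn_mod_dvd ?expn_gt0 ?prime_gt0 // Euler_exp_totient.
Qed.

Theorem theorem4 (p n : nat) (p_prime : prime p) (n_gt0 : 0 < n) :
  exists (gT : finGroupType) (G : {group gT}),
    [/\ solvable G,
        (exists2 P : {group gT}, (p.-Sylow(G) P)%g & abelian P),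
        max_irr_degree G = p ^ n
      & #|G : 'O_p(G)%g|%g`_p = p ^ n].
Proof.
have q_gt0 : 0 < p ^ n by rewrite expn_gt0 prime_gt0.
have [F q_dvd] := finField_dvdn_pred q_gt0.
have /cyclicP[u defU] := field_unit_group_cyclic [set: {unit F}].
rewrite -card_finField_unit defU in q_dvd.
have [C oC] : exists C : {group {unit F}}, #|C| = p ^ n.
  have [k ou] := dvdnP q_dvd; exists <[(u ^+ k)%g]>%G.
  have := order_gt0 u; rewrite [#[u]%g]ou muln_gt0 => /andP[k_gt0 _].
  by rewrite [#|_|]orderXdiv [#[u]%g]ou ?dvdn_mulr // mulKn.
have cycC : cyclic C := field_unit_group_cyclic C.
pose to := (scale_groupAction F 1 1 \ subsetT C)%gact.
have ntC : C :!=: 1%g by rewrite -cardG_gt1 oC -(exp1n n) ltn_exp2r ?prime_gt1.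
have pC : (p.-group C)%g by rewrite /pgroup oC pnatX pnat_id.
have frobG := Frobenius_scalar_action ntC.
have oH : #|sdpair2 to @* C|%g = p ^ n by rewrite card_injm ?injm_sdpair2.
have pH : (p.-group (sdpair2 to @* C))%g by rewrite morphim_pgroup.
have abH : abelian (sdpair2 to @* C)%g.
  by rewrite morphim_abelian ?cyclic_abelian.
have abK : abelian (sdpair1 to @* [set: 'M[F]_1])%g.
  by rewrite morphim_abelian // FinRing.zmod_abelian.
have sylH := compl_Frobenius_Sylow frobG pH.
exists (sdprod_by to), [set: sdprod_by to]%G; split.
- have [defG _ _ _ _] := Frobenius_context frobG.
  have [nsKG _ _ _ _] := sdprod_context defG.
  rewrite (series_sol nsKG) abelian_sol //=.
  by rewrite abelian_sol // -(isog_abelian (sdprod_isog defG)).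
- by exists (sdpair2 to @* C)%G.
- by rewrite (max_irr_degree_Frobenius frobG).
by rewrite (pcore_Frobenius_compl frobG) // indexg1 -(card_Hall sylH).
Qed.
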